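(* Let $d$ and $k$ be positive integers. Every $n$-vertex graph in the class $k^d_{\mathrm{DIR}}\text{-CONV}$ has at most $n^{d\cdot k^{d+1}}$ (inclusion-wise) maximal cliques.
   Context: All graphs are finite and nonempty. For a finite collection $R$ of sets, its intersection graph has one vertex for each member of $R$, and two distinct vertices are adjacent iff the corresponding sets have nonempty intersection. For a set $L$ of $k$ distinct $(d-1)$-dimensional hyperplanes in $\mathbb{R}^d$ containing the origin, $\mathcal{P}^d(L)$ is the set of all $d$-dimensional convex polytopes in $\mathbb{R}^d$ each of whose facets ($(d-1)$-dimensional faces) is parallel to one of the hyperplanes in $L$. The class $k^d_{\mathrm{DIR}(L)}\text{-CONV}$ consists of all intersection graphs of finite collections of polytopes in $\mathcal{P}^d(L)$, and $k^d_{\mathrm{DIR}}\text{-CONV}$ is the union of $k^d_{\mathrm{DIR}(L)}\text{-CONV}$ over all sets $L$ of $k$ distinct hyperplanes through the origin in $\mathbb{R}^d$. *)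

(* Defs.v *)
From HB Require Import structures.
From mathcomp Require Import all_boot all_order all_algebra.
From mathcomp Require Import finmap all_classical all_reals all_analysis.

Set Implicit Arguments.
Unset Strict Implicit.
Unset Printing Implicit Defensive.

Import Order.TTheory GRing.Theory Num.Theory.

Local Open Scope classical_set_scope.
Local Open Scope ring_scope.

Record sgraph := SGraph {
  svertex :> finType;
  sedge : rel svertex;
  sedge_sym : symmetric sedge;
  sedge_irr : irreflexive sedge }.

Definition clique (G : sgraph) (A : {set G}) : bool :=
  [forall u in A, forall v in A, (u != v) ==> sedge u v].

Definition maximal_cliques (G : sgraph) : {set {set G}} :=
  [set A : {set G} | maxset (@clique G) A]%SET.

Definition dotp (R : realType) (d : nat) (c x : 'rV[R]_d) : R :=
  \sum_(i < d) c 0 i * x 0 i.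

Definition conv_hull (R : realType) (d : nat) (S : set 'rV[R]_d) :
    set 'rV[R]_d :=
  smallest (@convex_set R 'rV[R]_d) S.

(* U is the direction (linear part) of the affine hull of A: the least linear
   subspace that contains all differences of points of A. *)
Definition direction (R : realType) (d : nat) (A : set 'rV[R]_d)
    (U : {vspace 'rV[R]_d}) : Prop :=
  (forall x y, A x -> A y -> x - y \in U) /\
  (forall W : {vspace 'rV[R]_d},
     (forall x y, A x -> A y -> x - y \in W) -> (U <= W)%VS).

(* Nonemptiness matters: the empty set would otherwise have dimension 0 and
   be a facet of every segment in dimension 1. *)
Definition affine_dim (R : realType) (d : nat) (A : set 'rV[R]_d) (m : nat) :
    Prop :=
  A !=set0 /\ exists2 U, direction A U & \dim U = m.

Definition polytope (R : realType) (d : nat) (P : set 'rV[R]_d) : Prop :=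
  exists2 S : set 'rV[R]_d, finite_set S & P = conv_hull S.

Definition face (R : realType) (d : nat) (P F : set 'rV[R]_d) : Prop :=
  exists (c : 'rV[R]_d) (b : R),
    (forall x, P x -> dotp c x <= b) /\ F = P `&` [set x | dotp c x = b].

(* Meant for a d-dimensional P in dimension d > 0. *)
Definition facet (R : realType) (d : nat) (P F : set 'rV[R]_d) : Prop :=
  face P F /\ affine_dim F d.-1.

(* The class P^d(L). A facet and a hyperplane through the origin have the same
   dimension, so they are parallel iff the hyperplane is the direction of the
   facet. *)
Definition polytopes_of (R : realType) (d : nat)
    (L : {fset {vspace 'rV[R]_d}}) (P : set 'rV[R]_d) : Prop :=
  [/\ polytope P, affine_dim P d &
      forall F, facet P F -> exists2 H, H \in L & direction F H].

(* The vertices of G index the collection, so graphs are taken up to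
   isomorphism. *)
Definition intersection_graph (T : Type) (G : sgraph) (S : G -> set T) : Prop :=
  forall u v : G, u != v -> (sedge u v <-> S u `&` S v !=set0).

(* k^d_DIR(L)-CONV, where k is the cardinality of L *)
Definition dirL_conv (R : realType) (d : nat) (L : {fset {vspace 'rV[R]_d}})
    (G : sgraph) : Prop :=
  exists2 S : G -> set 'rV[R]_d,
    forall v, polytopes_of L (S v) & intersection_graph S.

(* k^d_DIR-CONV. A hyperplane through the origin is a linear subspace of
   dimension d - 1. *)
Definition dir_conv (R : realType) (d k : nat) (G : sgraph) : Prop :=
  exists L : {fset {vspace 'rV[R]_d}},
    [/\ #|` L| = k, forall H, H \in L -> \dim H = d.-1 & dirL_conv L G].

(* Main.v *)
(* A d-dimensional polytope of P^d(L) is cut out by inequalities whose normals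
   are, up to sign, the normals of the members of L.  If two such polytopes P
   and Q are disjoint, Farkas' lemma applied to their joint system, with a
   Caratheodory-minimal certificate, involves at most d+1 constraints, and the
   separating functional spans the line in which the span of the normals coming
   from P meets the span of those coming from Q.  Recording how many of d+1
   slots belong to P (d choices) and which member of L fills each slot
   (k^(d+1) choices) gives m = d k^(d+1) directions that separate all disjoint
   pairs.  Hence the graph is the intersection of m interval graphs, and a
   maximal clique is determined by the m vertices whose intervals have the
   greatest left endpoints: at most n^m possibilities. *)
From HB Require Import structures.
Require Import Defs.
From mathcomp Require Import all_boot all_order all_algebra.
From mathcomp Require Import finmap all_classical all_reals all_analysis.
From mathcomp Require Import ring lra zify.

Set Implicit Arguments.
Unset Strict Implicit.
Unset Printing Implicit Defensive.

Import Order.TTheory GRing.Theory Num.Theory.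

Local Open Scope classical_set_scope.
Local Open Scope ring_scope.

(** * The dot product: bilinearity and definiteness *)

Section Dotp.
Variables (R : realType) (d : nat).
Implicit Types (a c x y : 'rV[R]_d).

Lemma dotpC c x : dotp c x = dotp x c.
Proof. by apply: eq_bigr => i _; rewrite mulrC. Qed.

Lemma dotpDr c x y : dotp c (x + y) = dotp c x + dotp c y.
Proof. by rewrite -big_split; apply: eq_bigr => i _; rewrite mxE mulrDr. Qed.

Lemma dotpZr c k x : dotp c (k *: x) = k * dotp c x.
Proof. by rewrite [RHS]mulr_sumr; apply: eq_bigr => i _; rewrite mxE mulrCA. Qed.

Lemma dotp_is_linear c : linear (dotp c : 'rV[R]_d -> R^o).
Proof. by move=> k x y; rewrite dotpDr dotpZr. Qed.

HB.instance Definition _ c :=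
  GRing.isLinear.Build R 'rV[R]_d R^o _ (dotp c) (dotp_is_linear c).

Lemma dotp0r c : dotp c 0 = 0. Proof. exact: linear0. Qed.
Lemma dotpNr c x : dotp c (- x) = - dotp c x. Proof. exact: linearN. Qed.
Lemma dotpBr c x y : dotp c (x - y) = dotp c x - dotp c y.
Proof. exact: linearB. Qed.
Lemma dotp_sumr (I : Type) (r : seq I) (P : pred I) c (F : I -> 'rV[R]_d) :
  dotp c (\sum_(i <- r | P i) F i) = \sum_(i <- r | P i) dotp c (F i).
Proof. exact: linear_sum. Qed.

Lemma dotpDl c x y : dotp (x + y) c = dotp x c + dotp y c.
Proof. by rewrite !(dotpC _ c) dotpDr. Qed.
Lemma dotpZl c k x : dotp (k *: x) c = k * dotp x c.
Proof. by rewrite !(dotpC _ c) dotpZr. Qed.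
Lemma dotp0l c : dotp 0 c = 0. Proof. by rewrite dotpC dotp0r. Qed.
Lemma dotpNl c x : dotp (- x) c = - dotp x c.
Proof. by rewrite !(dotpC _ c) dotpNr. Qed.
Lemma dotpBl c x y : dotp (x - y) c = dotp x c - dotp y c.
Proof. by rewrite !(dotpC _ c) dotpBr. Qed.

Lemma dotpp_eq0 x : (dotp x x == 0) = (x == 0).
Proof.
apply/idP/eqP => [|->]; last by rewrite dotp0r.
rewrite psumr_eq0 => [/allP x0|i _]; last by rewrite -expr2 sqr_ge0.
apply/rowP => i; rewrite mxE; apply/eqP.
by have /implyP/(_ isT) := x0 i (mem_index_enum _); rewrite mulf_eq0 orbb.
Qed.

Lemma dotpp_gt0 x : x != 0 -> 0 < dotp x x.
Proof.
move=> x0; rewrite lt_def dotpp_eq0 x0; apply: sumr_ge0 => i _.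
by rewrite -expr2 sqr_ge0.
Qed.

(** The component of [a] orthogonal to [c] is annihilated by [c], hence by [a], hence is orthogonal
    to itself. *)
Lemma dotp_ker_scale a c : (forall x, dotp c x = 0 -> dotp a x = 0) ->
  exists k, a = k *: c.
Proof.
move=> ca; have [c0|c0] := eqVneq c 0.
  exists 0; rewrite scale0r; apply/eqP; rewrite -dotpp_eq0 ca // c0 dotp0l //.
pose k := dotp a c / dotp c c; exists k; apply/eqP.
have cc : dotp c c != 0 by rewrite dotpp_eq0.
have ce : dotp c (a - k *: c) = 0 by rewrite dotpBr dotpZr divfK // dotpC subrr.
by rewrite -subr_eq0 -dotpp_eq0 dotpBl dotpZl ce (ca _ ce) mulr0 subrr.
Qed.

End Dotp.

(** * Farkas' lemma and minimal certificates *)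

Section Farkas.
Variables (R : realType) (N : nat) (I : finType).
Implicit Types (a : I -> 'rV[R]_N) (b : 'rV[R]_N) (l m : I -> R).

(* Bartl's induction: a vector y that separates b from all generators but a i0
   is used to project along a i0. *)
Lemma farkas_seq (r : seq I) : uniq r -> forall a b,
  (exists2 l, (forall i, 0 <= l i) & b = \sum_(i <- r) l i *: a i) \/
  (exists2 x, (forall i, i \in r -> dotp (a i) x <= 0) & 0 < dotp b x).
Proof.
elim: r => [_ a b|i0 r IH /= /andP[i0r /IH{}IH] a b].
  have [->|b0] := eqVneq b 0; [left|right]; last first.
    by exists b => //; exact: dotpp_gt0.
  by exists (fun=> 0) => //; rewrite big_nil.
have extend l c : (forall i, 0 <= l i) -> 0 <= c ->
    exists2 l', (forall i, 0 <= l' i) &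
    \sum_(i <- i0 :: r) l' i *: a i = c *: a i0 + \sum_(i <- r) l i *: a i.
  move=> l0 c0; exists (fun i => if i == i0 then c else l i).
    by move=> i; case: ifP.
  rewrite big_cons eqxx; congr (_ + _); apply: eq_big_seq => i ir.
  by case: eqP => // ii0; rewrite -ii0 ir in i0r.
case: (IH a b) => [[l l0 ->]|[y ay b_y]].
  have [l' l'0 E] := extend l 0 l0 (lexx 0); left; exists l' => //.
  by rewrite E scale0r add0r.
have [a0y|a0y] := leP (dotp (a i0) y) 0.
  by right; exists y => // i; rewrite inE => /predU1P[->|/ay].
pose t := dotp (a i0) y.
(* [pr] projects along [a i0] onto the vectors orthogonal to [y]. *)
pose pr v := v - (dotp v y / t) *: a i0.
case: (IH (pr \o a) (pr b)) => [[l l0 E]|[x ax bx]].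
  (* The coefficient collected by [a i0] is nonnegative because [y] is positive on [b] and
     nonpositive on the generators in [r]. *)
  left; have := extend l (dotp b y / t - \sum_(i <- r) l i * (dotp (a i) y / t)) l0.
  case.
    rewrite subr_ge0; apply: (@le_trans _ _ 0); last by rewrite divr_ge0 ?ltW.
    rewrite big_seq sumr_le0 // => i ir; rewrite mulr_ge0_le0 //.
    by rewrite mulr_le0_ge0 ?ay // invr_ge0 ltW.
  move=> l' l'0 E'; exists l' => //; rewrite E'.
  move/eqP: E; rewrite subr_eq => /eqP E; rewrite [LHS]E.
  rewrite scalerBl scaler_suml [LHS]addrC -addrA; congr (_ + _).
  rewrite [RHS]addrC -sumrB; apply: eq_bigr => i _ /=.
  by rewrite /pr scalerBr scalerA.
(* Correcting [x] by a multiple of [y] realizes the adjoint of [pr], and [pr] kills [a i0]. *)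
right; have prE v : dotp v (x - (dotp (a i0) x / t) *: y) = dotp (pr v) x.
  by rewrite dotpBr dotpZr dotpBl dotpZl; ring.
exists (x - (dotp (a i0) x / t) *: y); last by rewrite prE.
move=> i; rewrite inE => /predU1P[->|ir]; rewrite prE; last exact: ax.
by rewrite /pr divff ?scale1r ?subrr ?dotp0l // gt_eqF.
Qed.

Lemma farkas a b :
  (exists2 l, (forall i, 0 <= l i) & b = \sum_i l i *: a i) \/
  (exists2 x, (forall i, dotp (a i) x <= 0) & 0 < dotp b x).
Proof.
case: (farkas_seq (index_enum_uniq I) a b) => [|[x ax bx]]; [by left|right].
by exists x => // i; rewrite ax ?mem_index_enum.
Qed.

(** Independence of the family indexed by [J]: equal vectors at distinct indices count as dependent,
    so that the cardinality of [J] itself gets bounded. *)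
Definition independent_on a (J : {set I}) : Prop :=
  forall m, (forall i, i \notin J -> m i = 0) -> \sum_i m i *: a i = 0 ->
  forall i, m i = 0.

(** As long as the support of [l] carries a linear dependency, subtracting the largest multiple of
    it that keeps all coefficients nonnegative removes an index from the support. *)
Lemma caratheodory a l : (forall i, 0 <= l i) ->
  exists l', [/\ forall i, 0 <= l' i,
    \sum_i l' i *: a i = \sum_i l i *: a i &
    independent_on a [set i | l' i != 0]%SET].
Proof.
have [n] := ubnP #|[set i | l i != 0]%SET|.
elim: n l => // n IH l ln l0.
have [/= ind|] := pselect (independent_on a [set i | l i != 0]%SET); first by exists l.
move/existsNP => [m0 /not_implyP[supp0 /not_implyP[dep0 /existsNP[i0 /eqP mi0]]]].
have [m [suppm depm mpos]] : exists m, [/\ forall i, l i = 0 -> m i = 0,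
    \sum_i m i *: a i = 0 & 0 < m i0].
  have supp i : l i = 0 -> m0 i = 0 by move=> li; rewrite supp0 // inE li eqxx.
  have [mp|mn] := ltP 0 (m0 i0); first by exists m0.
  exists (fun i => - m0 i); split => [i /supp ->||]; first by rewrite oppr0.
    under eq_bigr do rewrite scaleNr.
    by rewrite sumrN dep0 oppr0.
  by rewrite oppr_gt0 lt_def eq_sym mi0.
(* The first coefficient to reach zero; [i0] guarantees that there is a candidate. *)
pose i1 := [arg min_(i < i0 | 0 < m i) (l i / m i)]%O.
have [mi1 i1min] : 0 < m i1 /\ forall i, 0 < m i -> l i1 / m i1 <= l i / m i.
  by rewrite /i1; case: arg_minP.
pose t := l i1 / m i1; pose l1 i := l i - t * m i.
have t0 : 0 <= t by rewrite divr_ge0 // ltW.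
have l10 i : 0 <= l1 i.
  rewrite subr_ge0; have [mi|mi] := ltP 0 (m i).
    by rewrite -ler_pdivlMr // i1min.
  exact: le_trans (mulr_ge0_le0 t0 mi) (l0 i).
have [||l' [l'0 l'E ind]] := IH l1 => //.
  rewrite -ltnS; apply: leq_trans ln; rewrite ltnS; apply: proper_card.
  apply/properP; split.
    apply/fintype.subsetP => i; rewrite !inE; apply: contraNneq => li.
    by rewrite /l1 (suppm _ li) li mulr0 subrr.
  exists i1; rewrite !inE.
    by apply: contraTneq mi1 => /suppm ->; rewrite ltxx.
  by rewrite negbK /l1 /t divfK ?subrr // gt_eqF.
exists l'; split => //; rewrite l'E.
under eq_bigr do rewrite scalerBl -scalerA.
by rewrite sumrB -scaler_sumr depm scaler0 subr0.
Qed.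

Lemma independent_card a (J : {set I}) : independent_on a J -> (#|J| <= N)%N.
Proof.
move=> ind; pose X := [tuple a (enum_val i) | i < #|J|].
suff: free X.
  rewrite /free size_tuple => /eqP <-.
  by rewrite (leq_trans (dimvS (subvf _))) // dimvf /dim /= mul1n.
apply/freeP => k E i.
pose m j := \sum_(i < #|J| | enum_val i == j) k i.
have mE i' : m (enum_val i') = k i'.
  rewrite /m (big_pred1 i') // => i1 /=; exact: (inj_eq enum_val_inj).
rewrite -mE; apply: ind => [j jJ|].
  by rewrite /m big_pred0 // => i1; apply: contraNF jJ => /eqP <-; exact: enum_valP.
rewrite -[RHS]E.
under eq_bigr do rewrite /m scaler_suml.
rewrite (exchange_big_dep xpredT) //=; apply: eq_bigr => i1 _.
rewrite (big_pred1 (enum_val i1)) => [|j]; last by rewrite eq_sym.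
by rewrite (nth_map i1) ?size_enum_ord // nth_ord_enum.
Qed.

(* Moving x along a functional that vanishes at b and on all tight generators
   makes a further generator tight. *)
Lemma tight_separation a b : (forall e, (forall i, dotp (a i) e = 0) -> e = 0) ->
  (exists2 x, (forall i, dotp (a i) x <= 0) & 0 < dotp b x) ->
  exists x, [/\ forall i, dotp (a i) x <= 0, 0 < dotp b x &
    forall e, (forall i, dotp (a i) x = 0 -> dotp (a i) e = 0) ->
      exists k, e = k *: x].
Proof.
move=> aspan [x]; have [n] := ubnP #|[set i | dotp (a i) x != 0]%SET|.
elim: n x => // n IH x xn ax bx.
have [|] := pselect (forall e, (forall i, dotp (a i) x = 0 -> dotp (a i) e = 0) ->
      exists k, e = k *: x); first by exists x.
move/existsNP => [e0 /not_implyP[e0t e0x]].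
(* Subtracting a multiple of [x] makes the move invisible to [b]. If all generators killed [e1],
   spanning would give [e1 = 0], and [e0] would be a multiple of [x]. *)
pose e1 := e0 - (dotp b e0 / dotp b x) *: x.
have e1b : dotp b e1 = 0 by rewrite dotpBr dotpZr divfK ?subrr // gt_eqF.
have e1t i : dotp (a i) x = 0 -> dotp (a i) e1 = 0.
  by move=> t; rewrite dotpBr dotpZr t e0t // mulr0 subrr.
have [i0 /eqP ei0] : exists i, dotp (a i) e1 <> 0.
  apply/existsNP => /aspan /eqP; rewrite subr_eq0 => /eqP E.
  by apply: e0x; exists (dotp b e0 / dotp b x).
have [e [eb et ei]] : exists e, [/\ dotp b e = 0,
    forall i, dotp (a i) x = 0 -> dotp (a i) e = 0 & 0 < dotp (a i0) e].
  have [ep|en] := ltP 0 (dotp (a i0) e1); first by exists e1.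
  exists (- e1); split => [|i t|]; rewrite dotpNr.
  - by rewrite e1b oppr0.
  - by rewrite e1t ?oppr0.
  - by rewrite oppr_gt0 lt_def eq_sym ei0.
(* Ratio test: [i1] is the first generator to become tight along [e]. *)
pose i1 := [arg min_(i < i0 | 0 < dotp (a i) e) (- dotp (a i) x / dotp (a i) e)]%O.
have [ei1 i1min] : 0 < dotp (a i1) e /\ forall i, 0 < dotp (a i) e ->
    - dotp (a i1) x / dotp (a i1) e <= - dotp (a i) x / dotp (a i) e.
  by rewrite /i1; case: arg_minP.
pose t := - dotp (a i1) x / dotp (a i1) e.
have t0 : 0 <= t by rewrite divr_ge0 ?oppr_ge0 // ltW.
apply: (IH (x + t *: e)).
- rewrite -ltnS; apply: leq_trans xn; rewrite ltnS; apply: proper_card.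
  apply/properP; split.
    apply/fintype.subsetP => i; rewrite !inE; apply: contraNneq => xi.
    by rewrite dotpDr dotpZr xi et // mulr0 addr0.
  exists i1; rewrite !inE; first by apply: contraTneq ei1 => /et ->; rewrite ltxx.
  by rewrite negbK dotpDr dotpZr /t divfK ?subrr // gt_eqF.
- move=> i; rewrite dotpDr dotpZr; have [ei'|ei'] := ltP 0 (dotp (a i) e).
    by rewrite -lerBrDl sub0r -ler_pdivlMr // i1min.
  by have := ax i; have := mulr_ge0_le0 t0 ei'; lra.
- by rewrite dotpDr dotpZr eb mulr0 addr0.
Qed.

End Farkas.


(** * Convex hulls and linear maxima over polytopes *)

Section Hull.
Variables (R : realType) (d : nat).
Implicit Types (c x y e : 'rV[R]_d) (S P F : set 'rV[R]_d).

Lemma convex_setE S : @convex_set R 'rV[R]_d S <->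
  forall x y (t : R), 0 <= t <= 1 -> S x -> S y -> S (t *: x + (1 - t) *: y).
Proof.
split => [cS x y t /andP[t0 t1] Sx Sy|cS x y t].
  have := cS x y (Itv01 t0 t1); rewrite !inE => /(_ Sx Sy).
  by [].
rewrite !inE => Sx Sy; apply: cS => //.
by rewrite ge0 le1.
Qed.

Lemma conv_hull_le S c (b : R) : (forall x, S x -> dotp c x <= b) ->
  forall x, conv_hull S x -> dotp c x <= b.
Proof.
move=> Sb; suff: conv_hull S `<=` [set x | dotp c x <= b] by [].
apply: smallest_sub => //; apply/convex_setE => x y t /andP[t0 t1] /= xb yb.
rewrite dotpDr !dotpZr (le_trans (lerD (ler_wpM2l t0 xb) (ler_wpM2l _ yb))) //.
  by rewrite subr_ge0.
by rewrite -mulrDl addrC subrK mul1r.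
Qed.

Lemma convex_comb (I : finType) S (p : I -> 'rV[R]_d) (l : I -> R) :
  @convex_set R 'rV[R]_d S -> (forall i, S (p i)) -> (forall i, 0 <= l i) ->
  \sum_i l i = 1 -> S (\sum_i l i *: p i).
Proof.
move=> /convex_setE cS Sp l0 l1.
(* The weights of a sublist no longer sum to 1, so the induction normalizes by their sum, kept
   positive for the inverse. *)
suff H (r : seq I) : 0 < \sum_(i <- r) l i ->
    S ((\sum_(i <- r) l i)^-1 *: \sum_(i <- r) l i *: p i).
  by have := H (index_enum I); rewrite l1 invr1 scale1r; apply.
elim: r => [|i r IH]; first by rewrite big_nil ltxx.
rewrite !big_cons; set s := \sum_(j <- r) l j; set v := \sum_(j <- r) _ => sp.
have : 0 <= s by rewrite sumr_ge0.
rewrite le_eqVlt => /predU1P[s0|s0].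
  have -> : v = 0.
    have/eqP := esym s0; rewrite /s psumr_eq0 => // /allP z.
    by rewrite /v big_seq big1 // => j /z /eqP ->; rewrite scale0r.
  by rewrite -s0 !addr0 in sp *; rewrite scalerA mulVf ?scale1r // gt_eqF.
have t01 : 0 <= l i / (l i + s) <= 1.
  by rewrite ler_pdivrMr // mul1r lerDl (ltW s0) divr_ge0 // ltW.
have := cS (p i) _ _ t01 (Sp i) (IH s0).
rewrite -/s -/v scalerA scalerDr scalerA [l i / _]mulrC.
by have -> : (1 - (l i + s)^-1 * l i) / s = (l i + s)^-1 by field; rewrite !gt_eqF.
Qed.

Lemma polytope_argmax P c : polytope P -> P !=set0 ->
  exists2 x, P x & forall y, P y -> dotp c y <= dotp c x.
Proof.
move=> [S /finite_seqP[s ->] ->] [x0 Px0].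
have [s0 _] : exists x : seq_sub s, True.
  case: s Px0 => [|y s] Px0; last by exists (SeqSub (mem_head y s)).
  (* An empty generating set would make the zero functional bounded by -1 on the hull. *)
  have /= := @conv_hull_le [set` [::]] 0 (-1) _ x0 Px0.
  by rewrite dotp0l => /(_ (fun x => ltac:(by [])))/=; rewrite lerNr oppr0 ler10.
have [/= m _ mP] := @arg_maxP _ _ _ s0 xpredT (fun x : seq_sub s => dotp c (val x)) isT.
exists (val m); first by apply: sub_gen_smallest; exact: valP.
move=> y; apply: conv_hull_le => x xs; exact: (mP (SeqSub xs) isT).
Qed.

End Hull.

(** * From affine to linear algebra in one more dimension *)

Section Homogenization.
Variables (R : realType) (d : nat).

(** The extra coordinate makes affine functions linear: pairing [homog c g] with [homog x 1] yields
    [dotp c x + g]. *)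
Definition homog (x : 'rV[R]_d) (t : R) : 'rV[R]_(d + 1) :=
  row_mx x (const_mx t).

Lemma dotp_homog x y s t : dotp (homog x s) (homog y t) = dotp x y + s * t.
Proof.
rewrite /dotp big_split_ord /= big_ord1; congr (_ + _).
  by apply: eq_bigr => i _; rewrite !row_mxEl.
by rewrite !row_mxEr !mxE.
Qed.

Lemma homogP (v : 'rV[R]_(d + 1)) : exists x t, v = homog x t.
Proof.
exists (lsubmx v), (v 0 (rshift d 0)); rewrite -[LHS]hsubmxK; congr row_mx.
by apply/rowP => i; rewrite !mxE !ord1.
Qed.

Lemma homog_inj x y s t : homog x s = homog y t -> x = y /\ s = t.
Proof. by move=> /eq_row_mx[-> /rowP/(_ 0)]; rewrite !mxE. Qed.

Lemma homogZ k x t : k *: homog x t = homog (k *: x) (k * t).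
Proof. by rewrite /homog scale_row_mx; congr row_mx; apply/rowP => i; rewrite !mxE. Qed.

Lemma homogD x y s t : homog x s + homog y t = homog (x + y) (s + t).
Proof. by rewrite /homog add_row_mx; congr row_mx; apply/rowP => i; rewrite !mxE. Qed.

Lemma homog_sum (I : finType) (l : I -> R) (x : I -> 'rV[R]_d) (t : I -> R) :
  \sum_i l i *: homog (x i) (t i) = homog (\sum_i l i *: x i) (\sum_i l i * t i).
Proof.
apply: (big_rec3 (fun u v w => u = homog v w)) => [|i u v w _ ->].
  by rewrite -[LHS](scale0r (homog 0 0)) homogZ scaler0 mulr0.
by rewrite homogZ homogD.
Qed.

End Homogenization.

(** * Facets of full-dimensional polytopes and their normals *)

Section Facets.
Variables (R : realType) (d : nat).
Implicit Types (c x y e : 'rV[R]_d) (S P F : set 'rV[R]_d).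

Definition orthv c : {vspace 'rV[R]_d} := lker (linfun (dotp c : 'rV[R]_d -> R^o)).

Lemma mem_orthv c x : (x \in orthv c) = (dotp c x == 0).
Proof. by rewrite memv_ker lfunE. Qed.

Lemma dim_orthv c : c != 0 -> \dim (orthv c) = d.-1.
Proof.
move=> c0; pose f := linfun (dotp c : 'rV[R]_d -> R^o).
have := limg_ker_dim f fullv; rewrite capfv dimvf /dim /= mul1n.
suff -> : \dim (limg f) = 1%N by rewrite addn1 => /(congr1 predn).
apply/eqP; rewrite eqn_leq; apply/andP; split.
  by rewrite (leq_trans (dimvS (subvf _))) // dimvf.
rewrite lt0n dimv_eq0; apply: contraNneq c0 => f0.
by have := memv_img f (memvf c); rewrite f0 memv0 lfunE /= dotpp_eq0.
Qed.

(** Farkas' lemma applied to a basis of [W] together with its negatives, which generate [W] as a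
    cone. *)
Lemma orthogonal_separation (W : {vspace 'rV[R]_d}) (v : 'rV[R]_d) : v \notin W ->
  exists2 e, (forall w, w \in W -> dotp e w = 0) & dotp e v != 0.
Proof.
move=> vW; pose b i := (vbasis W)`_i.
pose a (i : 'I_(\dim W) * bool) := (-1) ^+ i.2 *: b i.1.
have bW (i : 'I_(\dim W)) : b i \in W by rewrite vbasis_mem // mem_nth ?size_tuple.
case: (farkas a v) => [[l _ vE]|[e ae ve]].
  by case/negP: vW; rewrite vE; apply: memv_suml => i _; rewrite !memvZ.
exists e => [w wW|]; last by rewrite dotpC gt_eqF.
rewrite (coord_vbasis wW) dotp_sumr big1 // => i _.
suff be : dotp e (b i) = 0 by rewrite dotpZr be mulr0.
apply/eqP; rewrite eq_le dotpC; have := ae (i, true); have := ae (i, false).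
by rewrite /a /= expr0 expr1 scale1r scaleN1r dotpNl oppr_le0 => -> ->.
Qed.

Lemma orthv_normal (H : {vspace 'rV[R]_d}) : (0 < d)%N -> \dim H = d.-1 ->
  exists2 e, e != 0 & forall x, x \in H -> dotp e x = 0.
Proof.
move=> d0 dimH; have /subvPn[v _ vH] : ~~ (fullv <= H)%VS.
  apply/negP => /dimvS; rewrite dimvf /dim /= mul1n dimH.
  by rewrite leqNgt prednK // leqnn.
have [e eH ev] := orthogonal_separation vH.
by exists e => //; apply: contraNneq ev => ->; rewrite dotp0l.
Qed.

(** All differences of points of [P] are orthogonal to [e]; as they span the whole space, [e] is
    orthogonal to itself. *)
Lemma full_dim_affine_fun P e g : affine_dim P d ->
  (forall x, P x -> dotp e x + g = 0) -> e = 0 /\ g = 0.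
Proof.
move=> [[x0 Px0] [U [_ dirU] dimU]] eP.
suff e0 : e = 0 by split => //; have := eP _ Px0; rewrite e0 dotp0l add0r.
have UE : U = fullv.
  by apply/eqP; rewrite eqEdim subvf dimvf /dim /= mul1n dimU leqnn.
have : (U <= orthv e)%VS.
  have eE z : P z -> dotp e z = - g by move=> /eP/eqP; rewrite addr_eq0 => /eqP.
  by apply: dirU => x y Px Py; rewrite mem_orthv dotpBr !eE // subrr.
by rewrite UE => /subvP/(_ e (memvf _)); rewrite mem_orthv dotpp_eq0 => /eqP.
Qed.

(** The third hypothesis says, in dual form, that the tight points affinely span the whole
    supporting hyperplane. This is the shape in which [tight_separation] delivers it. *)
Lemma facet_of_tight (s : seq 'rV[R]_d) c (b : R) : c != 0 ->
  (forall x, x \in s -> dotp c x <= b) ->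
  (forall e g, (forall x, x \in s -> dotp c x = b -> dotp e x + g = 0) ->
     exists k, e = k *: c /\ g = k * - b) ->
  let F := conv_hull [set` s] `&` [set x | dotp c x = b] in
  facet (conv_hull [set` s]) F /\ direction F (orthv c).
Proof.
move=> c0 sb tight F.
(* Without a tight point the constant 1 would have to be a multiple of [dotp c x - b], which
   [c != 0] excludes. *)
have [x0 x0s x0b] : exists2 x, x \in s & dotp c x = b.
  apply: contrapT => no; have [|k [/esym/eqP]] := tight 0 1.
    by move=> x xs xb; case: no; exists x.
  rewrite scaler_eq0 (negPf c0) orbF => /eqP -> /eqP.
  by rewrite mul0r oner_eq0.
have sF x : x \in s -> dotp c x = b -> F x.
  by move=> xs xb; split => //; exact: sub_gen_smallest.
have dirF : direction F (orthv c).
  split => [x y [_ /= xb] [_ /= yb]|W WF].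
    by rewrite mem_orthv dotpBr xb yb subrr.
  apply/subvP => v; rewrite mem_orthv => /eqP cv; apply: contrapT => /negP.
  (* A functional that vanishes on [W] is constant on the tight points, hence a multiple of [c], and
     so kills [v]. *)
  move=> /orthogonal_separation[e eW /eqP]; apply.
  have [|k [-> _]] := tight e (- dotp e x0); last by rewrite dotpZl cv mulr0.
  by move=> x xs xb; rewrite -dotpBr eW // WF //; exact: sF.
do 2?split => //; last by split; [exists x0; exact: sF|exists (orthv c); rewrite ?dim_orthv].
by exists c, b; split => // x; exact: conv_hull_le.
Qed.

(* A point outside P violates a facet inequality, hence a bound in a direction
   orthogonal to some member of L. *)
Lemma polytopes_of_halfspaces (L : {fset {vspace 'rV[R]_d}}) P
    (n : {vspace 'rV[R]_d} -> 'rV[R]_d) x :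
  (forall H, H \in L -> n H != 0 /\ forall y, y \in H -> dotp (n H) y = 0) ->
  polytopes_of L P ->
  (forall H (t : bool), H \in L -> exists2 y, P y &
     dotp ((-1) ^+ t *: n H) x <= dotp ((-1) ^+ t *: n H) y) ->
  P x.
Proof.
move=> nL [polP dimP facP] xle; have [[p0 Pp0] _] := dimP.
have [S /finite_seqP[s ->] PE] := polP.
have sP y : y \in s -> P y by move=> ys; rewrite PE; exact: sub_gen_smallest.
apply: contrapT => nPx.
(* Conic combinations of these lifts with last coordinate 1 are convex combinations of [s], and full
   dimension of [P] makes the lifts span. *)
pose a (i : seq_sub s) := homog (val i) 1.
have aspan (e : 'rV_(d + 1)) : (forall i, dotp (a i) e = 0) -> e = 0.
  have [c [g ->]] := homogP e => ae.
  have cs y : y \in s -> dotp c y + g = 0.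
    by move=> ys; have := ae (SeqSub ys); rewrite dotp_homog mul1r dotpC.
  have [|-> ->] := @full_dim_affine_fun P c g dimP.
    move=> y; rewrite PE => Py; apply/eqP; rewrite eq_le; apply/andP; split.
      rewrite -lerBrDr sub0r; apply: conv_hull_le Py => z /cs /eqP.
      by rewrite addr_eq0 => /eqP ->.
    have : dotp (- c) y <= g.
      apply: conv_hull_le Py => z /cs /eqP.
      by rewrite addr_eq0 dotpNl => /eqP ->; rewrite opprK.
    by rewrite dotpNl lerNl -subr_ge0 opprK.
  by rewrite -(scale0r (homog 0 0)) homogZ scaler0 mulr0.
have [[l l0]|] := farkas a (homog x 1).
  rewrite homog_sum => /homog_inj[xE /esym l1]; apply: nPx.
  rewrite xE PE => C [cC sC]; apply: convex_comb => // [i|].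
    by apply: sC; exact: valP.
  by under eq_bigr do rewrite -[l _]mulr1.
(* [x] is cut off by an inequality that its tight points determine up to scaling, so these points
   yield a facet. *)
move=> /(tight_separation aspan)[v]; have [c [b' ->]] := homogP v.
rewrite -(opprK b'); move: (- b') => b [ab]; rewrite dotp_homog mul1r subr_gt0 dotpC => cx tight.
have cs y : y \in s -> dotp c y <= b.
  by move=> ys; have := ab (SeqSub ys); rewrite dotp_homog mul1r subr_le0 dotpC.
have cP y : P y -> dotp c y <= b by rewrite PE; exact: conv_hull_le.
have c0 : c != 0.
  apply: contraTneq cx => c0; rewrite -leNgt c0 dotp0l.
  by have := cP _ Pp0; rewrite c0 dotp0l.
have [|facF dirF] := facet_of_tight c0 cs.
  move=> e g es; have [|k] := tight (homog e g).
    move=> i; rewrite !dotp_homog !mul1r => /eqP; rewrite subr_eq0 => /eqP ci.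
    by rewrite dotpC es // ?(valP i) // dotpC.
  by rewrite homogZ => /homog_inj; exists k.
rewrite -PE in facF dirF; have [H HL dirH] := facP _ facF.
have HE : H = orthv c.
  by apply/eqP; rewrite eqEsubv dirH.2 ?dirF.2 //; [exact: dirH.1|exact: dirF.1].
have [nH0 nH] := nL H HL.
have [k nE] : exists k, n H = k *: c.
  by apply: dotp_ker_scale => y cy; rewrite nH // HE mem_orthv cy.
have k0 : k != 0 by apply: contraNneq nH0 => k0; rewrite nE k0 scale0r.
(* The sign follows that of [k], so that the signed normal is [|k|] times [c]. *)
have [y Py] := xle H (k < 0) HL.
rewrite nE scalerA mulr_sign.
have -> : (if k < 0 then - k else k) = `|k| by case: ltrgt0P.
rewrite !dotpZl ler_pM2l ?normr_gt0 // leNgt => /negP; apply.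
exact: le_lt_trans (cP y Py) cx.
Qed.

End Facets.

(** * Separating directions for disjoint polytopes *)

Section Separation.
Variables (R : realType) (d : nat) (K : finType) (n : K -> 'rV[R]_d).

(* When the two spans meet in a line, vpick returns a generator of it: the
   candidate separating direction is then determined, up to scaling, by which
   members of L are used in each of the two blocks. *)
Definition meet_direction (q : 'I_d * {ffun 'I_d.+1 -> K}) : 'rV[R]_d :=
  vpick ((\sum_(t < d.+1 | (t <= q.1)%N) <[n (q.2 t)]>) :&:
         (\sum_(t < d.+1 | (q.1 < t)%N) <[n (q.2 t)]>))%VS.

(** Since both blocks are nonempty, the last slot of the first one has an index below [d]; this is
    where the factor [d] of the bound comes from. *)
Lemma two_block_enum (sA sB : seq K) : sA != [::] -> sB != [::] ->
  (size sA + size sB <= d.+1)%N ->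
  exists q : 'I_d * {ffun 'I_d.+1 -> K},
    (forall h, h \in sA <-> exists2 t : 'I_d.+1, (t <= q.1)%N & q.2 t = h) /\
    (forall h, h \in sB <-> exists2 t : 'I_d.+1, (q.1 < t)%N & q.2 t = h).
Proof.
case: sA => // a sA _; case: sB => // b sB _ /= size_le.
have ad : (size sA < d)%N by lia.
pose s := (a :: sA) ++ (b :: sB).
(* [sA] and [sB] are now tails, so the first block ends at slot [size sA]. Spare slots repeat [b], a
   member of the second list. *)
exists (Ordinal ad, [ffun t : 'I_d.+1 => nth b s t]) => /=.
split => h; split.
- move=> hA; have hi : (index h (a :: sA) < size (a :: sA))%N by rewrite index_mem.
  have hd : (index h (a :: sA) < d.+1)%N by move: hi => /=; lia.
  by exists (Ordinal hd) => //; rewrite ffunE /s nth_cat hi nth_index.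
- move=> [t tA <-]; rewrite ffunE /s nth_cat ltnS tA.
  by apply: mem_nth; rewrite /= ltnS.
- move=> hB; have hi : (index h (b :: sB) < size (b :: sB))%N by rewrite index_mem.
  have hd : ((size sA).+1 + index h (b :: sB) < d.+1)%N by move: hi => /=; lia.
  exists (Ordinal hd) => /=; first lia.
  by rewrite ffunE /s nth_cat /= ltnNge leq_addr /= addKn nth_index.
- move=> [t tA <-]; rewrite ffunE /s nth_cat /= ltnNge tA /=.
  case: (ltnP (t - (size sA).+1) (size (b :: sB))) => ts; first exact: mem_nth.
  by rewrite nth_default // mem_head.
Qed.

Lemma line_sumP (I : finType) (p : pred I) (a : I -> 'rV[R]_d) v :
  (v \in \sum_(i | p i) <[a i]>)%VS ->
  exists m : I -> R, v = \sum_(i | p i) m i *: a i.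
Proof.
move=> /memv_sumP[vs vsa ->].
have /choice[m mE] : forall i, exists k, p i -> vs i = k *: a i.
  move=> i; case: (boolP (p i)) => [/vsa/vlineP[k kE]|_]; last by exists 0.
  by exists k.
by exists m; apply: eq_bigr.
Qed.

(** In a refutation of the joint system, the terms from [P] and from [Q] sum to opposite normals [u]
    and [- u]. Independence makes the two spans meet only in multiples of [u], so [meet_direction]
    recovers it from the labels alone. *)
Lemma disjoint_separation (P Q : set 'rV[R]_d) :
  polytope P -> polytope Q -> P !=set0 -> Q !=set0 ->
  (forall X x, X = P \/ X = Q -> (forall h (t : bool), exists2 y, X y &
     dotp ((-1) ^+ t *: n h) x <= dotp ((-1) ^+ t *: n h) y) -> X x) ->
  P `&` Q = set0 ->
  exists q, let w := meet_direction q in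
    (forall x y, P x -> Q y -> dotp w x < dotp w y) \/
    (forall x y, P x -> Q y -> dotp w y < dotp w x).
Proof.
move=> polP polQ P0 Q0 HPQ PQ0.
pose I : finType := (bool * (K * bool))%type.
pose X (b : bool) := if b then P else Q.
pose a (i : I) := (-1) ^+ i.2.2 *: n i.2.1.
have /choice[p pX] : forall i : I, exists p, X i.1 p /\
    forall y, X i.1 y -> dotp (a i) y <= dotp (a i) p.
  move=> [[] [h t]]; first by have [x] := polytope_argmax (a (true, (h, t))) polP P0; exists x.
  by have [x] := polytope_argmax (a (false, (h, t))) polQ Q0; exists x.
pose b i := dotp (a i) (p i).
(* A certificate derives [0 <= -1] from the supporting inequalities of both polytopes. In the other
   case [v] rescales to a common point. *)
have [[l0 l00]|[v]] := farkas (fun i => homog (a i) (b i)) (homog 0 (-1)); last first.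
  have [c [g ->]] := homogP v; rewrite dotp_homog dotp0l add0r mulN1r oppr_gt0.
  move=> ac g0; pose x := (- g)^-1 *: c.
  have ax i : dotp (a i) x <= dotp (a i) (p i).
    have := ac i; rewrite dotp_homog -/(b i) => abg.
    by rewrite dotpZr ler_pdivrMl ?oppr_gt0 // mulNr mulrC -subr_le0 opprK.
  suff : (P `&` Q) x by rewrite PQ0.
  split; apply: HPQ; [by left| |by right|] => h t.
    by have := ax (true, (h, t)); have [] := pX (true, (h, t)); exists (p (true, (h, t))).
  by have := ax (false, (h, t)); have [] := pX (false, (h, t)); exists (p (false, (h, t))).
move=> l0E; have [l [lge0 lE ind]] := caratheodory (fun i => homog (a i) (b i)) l00.
rewrite -{}l0E homog_sum in lE; have [la lb] := homog_inj lE.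
(* The lifted constraints live in dimension [d + 1], hence the [d.+1] slots. *)
set J := [set i | l i != 0]%SET in ind; have Jle := independent_card ind.
have l0J i : i \notin J -> l i = 0 by rewrite inE negbK => /eqP.
pose u := \sum_(i | i.1) l i *: a i; pose bP := \sum_(i | i.1) l i * b i.
have uQ : \sum_(i | ~~ i.1) l i *: a i = - u.
  have /eqP := la; rewrite (bigID (fun i : I => i.1)) /= addrC addr_eq0.
  by move=> /eqP.
have bQ : \sum_(i | ~~ i.1) l i * b i = - 1 - bP.
  by have := lb; rewrite (bigID (fun i : I => i.1)) /= => <-; rewrite addrAC subrr add0r.
have uPle x : P x -> dotp u x <= bP.
  move=> Px; rewrite dotpC dotp_sumr; apply: ler_sum => -[[] i] // _.
  by rewrite dotpZr dotpC ler_wpM2l // (pX (true, i)).2.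
have uQge y : Q y -> 1 + bP <= dotp u y.
  move=> Qy; rewrite -lerN2 -dotpNl -uQ opprD -bQ dotpC dotp_sumr.
  apply: ler_sum => -[[] i] // _.
  by rewrite dotpZr dotpC ler_wpM2l // (pX (false, i)).2.
have sep x y : P x -> Q y -> dotp u x < dotp u y.
  by move=> /uPle ux /uQge uy; lra.
have u0 : u != 0.
  have [[x Px] [y Qy]] := (P0, Q0); apply: contraTneq (sep x y Px Qy) => ->.
  by rewrite !dotp0l ltxx.
pose A := (\sum_(i in J | i.1) <[a i]>)%VS.
pose B := (\sum_(i in J | ~~ i.1) <[a i]>)%VS.
have uA : u \in A.
  rewrite /u (bigID (mem J)) /= [X in _ + X]big1 ?addr0 => [|i /andP[_ /l0J->]]; last first.
    by rewrite scale0r.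
  rewrite (eq_bigl (fun i => (i \in J) && i.1)) => [|i]; last by rewrite andbC.
  by apply: memv_suml => i iJ; apply/memvZ/(sumv_sup i) => //; rewrite memv_line.
have uB : u \in B.
  rewrite -memvN -uQ (bigID (mem J)) /= [X in _ + X]big1 ?addr0 => [|i /andP[_ /l0J->]]; last first.
    by rewrite scale0r.
  rewrite (eq_bigl (fun i => (i \in J) && ~~ i.1)) => [|i]; last by rewrite andbC.
  by apply: memv_suml => i iJ; apply/memvZ/(sumv_sup i) => //; rewrite memv_line.
(* A combination of z and u kills all the homogenized generators, hence is
   trivial by independence. *)
have lineAB z : z \in (A :&: B)%VS -> exists k, z = k *: u.
  rewrite memv_cap => /andP[/line_sumP[mA zA] /line_sumP[mB zB]].
  pose m0 i := if i \in J then (if i.1 then mA i else - mB i) else 0.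
  (* The last coordinate of the certificate [l] is -1, so adding [r] times [l] cancels the last
     coordinate [r] left by [m0]. *)
  pose r := \sum_i m0 i * b i; pose m i := m0 i + r * l i.
  have m0a : \sum_i m0 i *: a i = 0.
    rewrite (bigID (mem J)) /= [X in _ + X]big1 ?addr0 => [|i /negPf iJ]; last first.
      by rewrite /m0 iJ scale0r.
    rewrite (bigID (fun i : I => i.1)) /= -[RHS](subrr z) {1}zA zB -sumrN.
    congr (_ + _); apply: eq_bigr => i /andP[iJ i1]; first by rewrite /m0 iJ i1.
    by rewrite /m0 iJ (negPf i1) scaleNr.
  have mz i : m i = 0.
    apply: (ind m) => [j jJ|]; first by rewrite /m /m0 (negPf jJ) l0J // mulr0 addr0.
    under eq_bigr do rewrite scalerDl -scalerA.
    rewrite big_split /= -scaler_sumr !homog_sum m0a la lb homogZ homogD.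
    rewrite scaler0 mulrN1 subrr addr0 -(scale0r (homog 0 0)) homogZ.
    by rewrite scaler0 mulr0.
  exists (- r); rewrite zA /u scaler_sumr [RHS](bigID (mem J)) /=.
  rewrite [X in _ + X]big1 ?addr0 => [|i /andP[_ /l0J->]]; last first.
    by rewrite scale0r scaler0.
  rewrite [RHS](eq_bigl (fun i => (i \in J) && i.1)) => [|i]; last by rewrite andbC.
  apply: eq_bigr => i /andP[iJ i1]; rewrite scalerA; congr (_ *: _).
  by have /eqP := mz i; rewrite /m /m0 iJ i1 addr_eq0 mulNr => /eqP.
pose sA := [seq i.2.1 | i <- enum [pred i in J | i.1]].
pose sB := [seq i.2.1 | i <- enum [pred i in J | ~~ i.1]].
have neA : sA != [::].
  apply: contraNneq u0 => /eqP; rewrite -size_eq0 size_map -cardE => /eqP/card0_eq A0.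
  by move: uA; rewrite /A big_pred0 ?memv0.
have neB : sB != [::].
  apply: contraNneq u0 => /eqP; rewrite -size_eq0 size_map -cardE => /eqP/card0_eq A0.
  by move: uB; rewrite /B big_pred0 ?memv0.
have sAB : (size sA + size sB <= d.+1)%N.
  rewrite !size_map -!cardE -addn1; apply: leq_trans Jle.
  by rewrite -(cardID (fun i : I => i.1) (mem J)) leq_add // subset_leq_card //;
    apply/fintype.subsetP => i; rewrite !inE // andbC.
have [q [qA qB]] := two_block_enum neA neB sAB.
have lineE i : (<[a i]> = <[n i.2.1]>)%VS.
  apply: subv_anti; rewrite -!memvE /a memvZ ?memv_line //=.
  by rewrite -{1}[n i.2.1](signrZK (i.2.2)) memvZ // memv_line.
have AE : (\sum_(t < d.+1 | (t <= q.1)%N) <[n (q.2 t)]>)%VS = A.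
  apply: subv_anti; apply/andP; split; apply/subv_sumP.
    move=> t tq; have /mapP[i] : q.2 t \in sA by apply/qA; exists t.
    rewrite mem_enum => /andP[iJ i1] ->; apply: (sumv_sup i); first by rewrite iJ.
    by rewrite lineE.
  move=> i iJ; have /qA[t tq tE] : i.2.1 \in sA by apply: map_f; rewrite mem_enum.
  by rewrite lineE -tE (sumv_sup t).
have BE : (\sum_(t < d.+1 | (q.1 < t)%N) <[n (q.2 t)]>)%VS = B.
  apply: subv_anti; apply/andP; split; apply/subv_sumP.
    move=> t tq; have /mapP[i] : q.2 t \in sB by apply/qB; exists t.
    rewrite mem_enum => /andP[iJ i1] ->; apply: (sumv_sup i); first by rewrite iJ.
    by rewrite lineE.
  move=> i iJ; have /qB[t tq tE] : i.2.1 \in sB by apply: map_f; rewrite mem_enum.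
  by rewrite lineE -tE (sumv_sup t).
exists q; rewrite /meet_direction AE BE; set w := vpick _.
(* [u] lies in both spans, so the picked vector is nonzero; the sign of its ratio to [u] decides the
   order of the two projections. *)
have w0 : w != 0.
  rewrite vpick0; apply: contraNneq u0 => AB0.
  by rewrite -memv0 -AB0 memv_cap uA.
have [k wE] := lineAB w (memv_pick _).
have [k0|k0|k0] := ltrgt0P k; last by rewrite wE k0 scale0r eqxx in w0.
  by left => x y Px Qy; rewrite wE !dotpZl ltr_pM2l // sep.
by right => x y Px Qy; rewrite wE !dotpZl ltr_nM2l // sep.
Qed.

End Separation.

(** * Maximal cliques in an intersection of interval graphs *)

Section Counting.
Variables (R : realType) (G : sgraph) (J : finType).

(* Helly's theorem on a line: for each j, a clique is contained in the set of
   vertices whose j-th interval contains the greatest left endpoint. *)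
Lemma box_graph_maximal_cliques (lo hi : J -> G -> R) :
  (0 < #|G|)%N -> (forall j v, lo j v <= hi j v) ->
  (forall u v, u != v ->
    (sedge u v <-> forall j, lo j u <= hi j v /\ lo j v <= hi j u)) ->
  (#|maximal_cliques G| <= #|G| ^ #|J|)%N.
Proof.
move=> /card_gt0P[v0 _] lohi edgeE.
(* [v0] makes [F] total, the empty set having no vertex to start from. *)
pose F (A : {set G}) : {ffun J -> G} :=
  [ffun j => [arg max_(v > odflt v0 [pick v in A] in A) lo j v]%O].
have FP (A : {set G}) : A != finset.set0 -> forall j, F A j \in A /\
    forall u, u \in A -> lo j u <= lo j (F A j).
  move=> /set0Pn[a aA] j; rewrite /F ffunE.
  case: pickP => [v vA|/(_ a)]; last by rewrite aA.
  by case: arg_maxP.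
have cliqueP (A : {set G}) : reflect
    (forall u v, u \in A -> v \in A -> u != v -> sedge u v) (clique A).
  apply: (iffP forall_inP) => [cA u v uA vA uv|cA u uA].
    by have /forall_inP/(_ v vA)/implyP/(_ uv) := cA u uA.
  by apply/forall_inP => v vA; apply/implyP; exact: cA.
have ne (A : {set G}) : A \in maximal_cliques G -> A != finset.set0.
  rewrite inE => /maxsetP[_ maxA]; apply/negP => /eqP A0.
  have /maxA/(_ _)/setP/(_ v0) : clique [set v0]%SET.
    by apply/cliqueP => u v; rewrite !inE => /eqP-> /eqP->; rewrite eqxx.
  by rewrite A0 finset.sub0set !inE eqxx => /(_ isT).
rewrite -card_ffun -(card_in_imset (f := F)); first exact: max_card.
move=> A B Am Bm FAB.
(* [C] depends on [A] only through [F A], and it is a clique because for each [j] its intervals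
   share a point. A maximal clique with the same [F] lies in [C], hence equals it. *)
pose C := [set u | [forall j, lo j u <= lo j (F A j) <= hi j u]]%SET.
have sub (D : {set G}) : D \in maximal_cliques G -> F D = F A -> D \subset C.
  move=> Dm FD; apply/fintype.subsetP => u uD; rewrite inE; apply/forallP => j.
  have [FDj le_FDj] := FP D (ne D Dm) j; rewrite -FD le_FDj //=.
  have [<-|uv] := eqVneq u (F D j); first exact: lohi.
  move: Dm; rewrite inE => /maxsetP[/cliqueP cD _].
  by have /(edgeE _ _ uv)/(_ j)[] := cD _ _ uD FDj uv.
have cC : clique C.
  apply/cliqueP => u v; rewrite !inE => /forallP uC /forallP vC uv.
  apply/(edgeE _ _ uv) => j; have /andP[u1 u2] := uC j; have /andP[v1 v2] := vC j.
  by split; [exact: le_trans u1 v2|exact: le_trans v1 u2].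
have eqC (D : {set G}) : D \in maximal_cliques G -> F D = F A -> C = D.
  move=> Dm FD; have sDC := sub D Dm FD; move: Dm; rewrite inE => /maxsetP[_ maxD].
  exact: maxD.
by rewrite -(eqC A Am erefl) (eqC B Bm (esym FAB)).
Qed.

End Counting.

(** * The interval representation given by the candidate directions *)

Theorem theorem9 (R : realType) (d k n : nat) (G : sgraph)
  (d_gt0 : (0 < d)%N) (k_gt0 : (0 < k)%N)
  (G_nonempty : (0 < #|G|)%N) (G_card : #|G| = n)
  (G_conv : dir_conv R d k G) :
  (#|maximal_cliques G| <= n ^ (d * k ^ d.+1))%N.
Proof.
have [L [cardL dimL [S SL SG]]] := G_conv.
have polS v : polytope (S v) by have [] := SL v.
have S0 v : S v !=set0 by have [_ []] := SL v.
have /choice[nv nvP] : forall H, exists e : 'rV[R]_d, H \in L ->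
    e != 0 /\ forall x, x \in H -> dotp e x = 0.
  move=> H; case: (boolP (H \in L)) => [HL|_]; last by exists 0.
  by have [e e0 eH] := orthv_normal d_gt0 (dimL H HL); exists e.
pose K : finType := L; pose J : finType := ('I_d * {ffun 'I_d.+1 -> K})%type.
have <- : #|J| = (d * k ^ d.+1)%N.
  by rewrite card_prod card_ffun !card_ord -cardfE cardL.
pose w (j : J) := meet_direction (fun H : K => nv (val H)) j.
(* The projection of [S v] along [w j] runs from its value at [bot] to its value at [top]. Where the
   spans meet trivially, [w j] is zero and all intervals reduce to the point 0, so no pair is
   separated. *)
have /choice[top topP] : forall x : J * G, exists p, S x.2 p /\
    forall y, S x.2 y -> dotp (w x.1) y <= dotp (w x.1) p.
  by move=> [j v]; have [p] := polytope_argmax (w j) (polS v) (S0 v); exists p.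
have /choice[bot botP] : forall x : J * G, exists p, S x.2 p /\
    forall y, S x.2 y -> dotp (w x.1) p <= dotp (w x.1) y.
  move=> [j v]; have [p Sp pm] := polytope_argmax (- w j) (polS v) (S0 v).
  by exists p; split => // y /pm; rewrite !dotpNl lerN2.
rewrite -G_card.
apply: (@box_graph_maximal_cliques R G J (fun j v => dotp (w j) (bot (j, v)))
  (fun j v => dotp (w j) (top (j, v)))) => //.
  by move=> j v; apply: (topP (j, v)).2; exact: (botP (j, v)).1.
move=> u v uv; rewrite SG //; split => [[x [ux vx]] j|le_uv].
  by split; [apply: (@le_trans _ _ (dotp (w j) x))|apply: (@le_trans _ _ (dotp (w j) x))];
    do ?[exact: (botP (j, u)).2|exact: (botP (j, v)).2|exact: (topP (j, u)).2|exact: (topP (j, v)).2].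
(* Disjoint polytopes have disjoint projections in some candidate direction, against the assumed
   overlap. *)
apply/set0P/eqP => uv0.
have Shalf X x : X = S u \/ X = S v -> (forall (H : K) (t : bool), exists2 y, X y &
    dotp ((-1) ^+ t *: nv (val H)) x <= dotp ((-1) ^+ t *: nv (val H)) y) -> X x.
  move=> uvX le_x; suff SX : polytopes_of L X.
    apply: (polytopes_of_halfspaces nvP SX) => H t HL; exact: le_x [` HL]%fset t.
  by case: uvX => ->.
have [j sep] := disjoint_separation (polS u) (polS v) (S0 u) (S0 v) Shalf uv0.
have [le_u le_v] := le_uv j.
case: sep => /= sep.
  by have := sep _ _ (topP (j, u)).1 (botP (j, v)).1; rewrite ltNge le_v.
by have := sep _ _ (botP (j, u)).1 (topP (j, v)).1; rewrite ltNge le_u.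
Qed.
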